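(* Let $A$, $B$, $C$ be $m \times n$ matrices over $\{-1,0,1\}$ such that $A$ has an entry $0$ and $(A,B,C)$ is neither independent from $B$ nor independent from $C$. Suppose $A$ and $C$ are not layered matrices and $B$ is a layered matrix. Then ${\rm IST}(A,B,C)=\infty$ if and only if every row of $A$ and every row of $C$ is one of the strings $1^{n-1}0$, $1^{n-1}(-1)$, and $B$ is the all-$1$ matrix.
   Context: Rows of matrices are written as strings; $x^r$ denotes the symbol $x$ repeated $r$ times. For an $m\times n$ matrix $M=[m_{ij}]$ over $\{-1,0,1\}$, $G_o(M)$ is the directed graph on $\{1,\dots,n+m\}$ with edges $j\to i$ for all $1\le j<i\le n$, and for $1\le p\le m$, $1\le j\le n$: an edge $j\to n+p$ if $m_{pj}=1$, an edge $n+p\to j$ if $m_{pj}=-1$, no edge if $m_{pj}=0$; no edges among $n+1,\dots,n+m$. A directed graph is semi-transitive if it is acyclic and for every directed path $u_1\to\cdots\to u_t$, $t\ge2$, either there is no edge $u_1\to u_t$ or all edges $u_i\to u_j$ ($1\le i<j\le t$) exist. For $m\times n$ matrices $A,B,C$ over $\{-1,0,1\}$, the morphism $\varphi$ replaces each entry $0,1,-1$ by the block $A,B,C$ respectively; $M^k(A,B,C)=\varphi^k([0])$ and $G_o^k(A,B,C)=G_o(M^k(A,B,C))$. If $A$ has an entry $0$, ${\rm IST}(A,B,C)$ is the least $\ell\ge0$ with $G_o^\ell(A,B,C)$ not semi-transitive, or $\infty$ if none exists. A matrix is layered if all entries in each row are identical. $(A,B,C)$ is independent from $B$ if there are no $1$'s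 in $A$ and $C$; it is independent from $C$ if there are no $(-1)$'s in $A$ and $B$. *)

(* Defs.v *)
From mathcomp Require Import all_boot all_order all_algebra.
From mathcomp Require Import boolp.

Set Implicit Arguments.
Unset Strict Implicit.
Unset Printing Implicit Defensive.

Import Order.TTheory GRing.Theory Num.Theory.
Local Open Scope ring_scope.

Definition ternary m n (M : 'M[int]_(m, n)) : Prop :=
  forall i j, M i j \in [:: -1; 0; 1].

(* The last branch is meant for the symbol -1; matrices over {-1, 0, 1} never
   feed it anything else. *)
Definition block m n (A B C : 'M[int]_(m, n)) (x : int) : 'M[int]_(m, n) :=
  if x == 0 then A else if x == 1 then B else C.

Lemma ord_div_proof p d (i : 'I_(p * d)) : (i %/ d < p)%N.
Proof.
have d_gt0 : (0 < d)%N.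
  by case: d i => [|//] i; have := ltn_ord i; rewrite [X in (_ < X)%N]muln0.
by rewrite ltn_divLR.
Qed.

Lemma ord_mod_proof p d (i : 'I_(p * d)) : (i %% d < d)%N.
Proof.
apply: ltn_pmod.
by case: d i => [|//] i; have := ltn_ord i; rewrite [X in (_ < X)%N]muln0.
Qed.

Definition ord_div p d (i : 'I_(p * d)) : 'I_p := Ordinal (ord_div_proof i).
Definition ord_mod p d (i : 'I_(p * d)) : 'I_d := Ordinal (ord_mod_proof i).

Definition phi m n (A B C : 'M[int]_(m, n)) p q (X : 'M[int]_(p, q)) :
    'M[int]_(p * m, q * n) :=
  \matrix_(i, j)
    block A B C (X (ord_div i) (ord_div j)) (ord_mod i) (ord_mod j).

Fixpoint phi_iter m n (A B C : 'M[int]_(m, n)) (k : nat) :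
    'M[int]_(m ^ k, n ^ k) :=
  if k is k'.+1 then
    castmx (esym (expnSr m k'), esym (expnSr n k'))
      (phi A B C (phi_iter A B C k'))
  else const_mx 0.

(* The vertices 1, ..., n + m are 0, ..., n + m - 1 here: [inl j] is the column
   vertex j and [inr p] is the row vertex n + p. *)
Definition Go m n (M : 'M[int]_(m, n)) : rel 'I_(n + m) :=
  fun u v =>
    match split u, split v with
    | inl j, inl i => (j < i)%N
    | inl j, inr p => M p j == 1
    | inr p, inl j => M p j == -1
    | inr _, inr _ => false
    end.

Definition acyclic (T : Type) (e : rel T) : Prop :=
  forall s : seq T, s <> [::] -> ~~ cycle e s.

(* The directed path u_1 -> ... -> u_t is [u :: s], with t >= 2. *)
Definition semi_transitive (T : Type) (e : rel T) : Prop :=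
  acyclic e /\
  forall (u : T) (s : seq T), s <> [::] -> path e u s ->
    ~~ e u (last u s) \/ pairwise e (u :: s).

Definition Go_iter m n (A B C : 'M[int]_(m, n)) (k : nat) :
    rel 'I_(n ^ k + m ^ k) :=
  Go (phi_iter A B C k).

Arguments Go_iter [m n] A B C k.

(* [None] is infinity. *)
Definition IST m n (A B C : 'M[int]_(m, n)) : option nat :=
  let P l := `[< ~ semi_transitive (Go_iter A B C l) >] in
  if pselect (exists l, P l) is left exP then Some (ex_minn exP) else None.

Definition layered m n (M : 'M[int]_(m, n)) : Prop :=
  forall i j j', M i j = M i j'.

Definition independent_from_B m n (A B C : 'M[int]_(m, n)) : Prop :=
  forall i j, A i j <> 1 /\ C i j <> 1.

Definition independent_from_C m n (A B C : 'M[int]_(m, n)) : Prop :=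
  forall i j, A i j <> -1 /\ B i j <> -1.

Definition row_string m n (M : 'M[int]_(m, n)) (i : 'I_m) : seq int :=
  [seq M i j | j <- enum 'I_n].

(* Main.v *)
Require Import Defs.
From mathcomp Require Import all_boot all_order all_algebra.
From mathcomp Require Import boolp zify.
Local Open Scope ring_scope.

(** If every power is semi-transitive, then no row of a power contains two 0s or
    two -1s: it would give, one step later, a row with a subsequence uvuv where
    u and v are distinct, and none of these is allowed.  As B is layered, this
    makes B the all-1 matrix, so some row r1 of A contains a -1.  Rows (P, r1)
    of the next power then show that no row P of a power has a 0 before a -1;
    rows (r, r1) and (r1, r) of the second power force the rows of A and C to
    start with 1^(n-1), and two rows 1..1 and 1..(-1) create a shortcut.
    Conversely, under the stated condition every row of a power is 1..10 or
    1..1(-1), and the graph is then a strict partial order. *)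

Set Implicit Arguments.
Unset Strict Implicit.
Unset Printing Implicit Defensive.

(** * Infinite index and transitive relations *)

Lemma IST_NoneP m n (A B C : 'M[int]_(m, n)) :
  IST A B C = None <-> forall l, semi_transitive (Go_iter A B C l).
Proof.
rewrite /IST; case: pselect => [exP|nex]; split=> // h.
- by have [l /asboolP[]] := exP.
- by move=> l; apply: contrapT => nst; apply: nex; exists l; apply/asboolP.
Qed.

Lemma transitive_semi_transitive (T : Type) (e : rel T) :
  irreflexive e -> transitive e -> semi_transitive e.
Proof.
move=> eI eT; split=> [[|x s] // _|u s _ us]; last first.
  by right; rewrite -(sorted_pairwise eT).
by apply/negP=> /(order_path_min eT); rewrite all_rcons eI.
Qed.

(** * Patterns forbidden in a semi-transitive graph *)

Section Graph.
Context {m n : nat} (M : 'M[int]_(m, n)).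
Let col (j : 'I_n) : 'I_(n + m) := lshift m j.
Let row (p : 'I_m) : 'I_(n + m) := rshift n p.

Let splitl j : split (col j) = inl j.
Proof. exact: (unsplitK (inl j)). Qed.

Let splitr p : split (row p) = inr p.
Proof. exact: (unsplitK (inr p)). Qed.

Let GoE := (splitl, splitr).

Lemma Go_irreflexive : irreflexive (Go M).
Proof. by move=> u; rewrite /Go; case: (split u) => // j; rewrite ltnn. Qed.

(** Row vertices receive edges from all columns but the last and send one at most to the last, so no
    path joins two row vertices. *)
Lemma Go_transitive :
  (forall p j, (M p j == 1) = (j.+1 < n)%N) ->
  (forall p j, M p j = -1 -> j.+1 = n) -> transitive (Go M).
Proof.
move=> h1 hN v u w; rewrite /Go.
case: (split u) (split v) (split w) => [a|p] [b|q] [c|r] //=; rewrite ?h1.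
- exact: ltn_trans.
- lia.
- by move=> a_lt /eqP/hN; lia.
- by move=> /eqP/hN; have := ltn_ord c; lia.
- by move=> /eqP/hN; lia.
Qed.

Hypothesis M_st : semi_transitive (Go M).
Let M_ac := M_st.1.

Let no_shortcut u s := M_st.2 u s.

Implicit Types (p q : 'I_m) (i j k : 'I_n).

(** The edges [row p -> col i -> col j -> row p] would form a cycle. *)
Lemma row_no_neg1_1 p i j : (i < j)%N -> M p i = -1 -> M p j = 1 -> False.
Proof.
move=> ij hi hj; have := M_ac (s := [:: row p; col i; col j]).
by rewrite /= /Go !GoE hi hj ij; case.
Qed.

(** The path [col i -> col k -> col j -> row p] has the edge [col i -> row p], which forces
    [col k -> row p]. *)
Lemma row_1_convex p i k j :
  (i < k < j)%N -> M p i = 1 -> M p j = 1 -> M p k = 1.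
Proof.
case/andP=> ik kj hi hj.
have := @no_shortcut (col i) [:: col k; col j; row p].
rewrite /= /Go !GoE hi hj ik kj (ltn_trans ik kj) /=.
by case=> //; case: (M p k =P 1).
Qed.

Lemma row_neg1_convex p i k j :
  (i < k < j)%N -> M p i = -1 -> M p j = -1 -> M p k = -1.
Proof.
case/andP=> ik kj hi hj.
have := @no_shortcut (row p) [:: col i; col k; col j].
rewrite /= /Go !GoE hi hj ik kj (ltn_trans ik kj) /=.
by case=> //; case: (M p k =P -1).
Qed.

(** The path [col i -> row p -> col j -> col k] would have the edge [col i -> col k] but lack
    [row p -> col k]. *)
Lemma row_no_1_neg1_0 p i j k :
  (i < j < k)%N -> M p i = 1 -> M p j = -1 -> M p k = 0 -> False.
Proof.
case/andP=> ij jk hi hj hk.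
have := @no_shortcut (col i) [:: row p; col j; col k].
rewrite /= /Go !GoE hi hj hk ij jk (ltn_trans ij jk) /=.
by case.
Qed.

(** The path [col i -> row p -> col j -> row q] would have the edge [col i -> row q], yet two row
    vertices are never adjacent. *)
Lemma no_11_over_1neg1 p q i j :
  M p i = 1 -> M p j = -1 -> M q i = 1 -> M q j = 1 -> False.
Proof.
move=> pi pj qi qj.
have := @no_shortcut (col i) [:: row p; col j; row q].
rewrite /= /Go !GoE pi pj qi qj /= => /(_ _ _)[] //.
by rewrite !andbF.
Qed.

(** If one symbol is 0, the other is separated by it, against convexity; otherwise some -1 precedes
    a 1. *)
Lemma row_no_uvuv p (i1 j1 i2 j2 : 'I_n) :
  ternary M -> (i1 < j1)%N -> (j1 < i2)%N -> (i2 < j2)%N ->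
  M p i1 <> M p j1 -> M p i2 = M p i1 -> M p j2 = M p j1 -> False.
Proof.
move=> tM lt1 lt2 lt3.
have lt12 : (i1 < j1 < i2)%N by rewrite lt1.
have lt23 : (j1 < i2 < j2)%N by rewrite lt2.
have := (tM p i1, tM p j1); rewrite !inE.
case=> /or3P[]/eqP e1 /or3P[]/eqP e2; rewrite e1 e2 // => _ e3 e4.
- by have := row_neg1_convex lt12 e1 e3; rewrite e2.
- exact: row_no_neg1_1 lt1 e1 e2.
- by have := row_neg1_convex lt23 e2 e4; rewrite e3.
- by have := row_1_convex lt23 e2 e4; rewrite e3.
- exact: row_no_neg1_1 lt2 e2 e3.
- by have := row_1_convex lt12 e1 e3; rewrite e2.
Qed.

End Graph.

(** * Block coordinates in the powers of the morphism *)

Section Powers.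
Context {m n : nat} (A B C : 'M[int]_(m, n)).
Local Notation M k := (phi_iter A B C k).
Local Notation block := (block A B C).

Lemma pair_ord_proof p d (i : 'I_p) (j : 'I_d) : (i * d + j < p * d)%N.
Proof. by have := (ltn_ord i, ltn_ord j); case; nia. Qed.

Definition pair_ord p d (i : 'I_p) (j : 'I_d) : 'I_(p * d) :=
  Ordinal (pair_ord_proof i j).

Lemma ord_div_pair p d (i : 'I_p) (j : 'I_d) : ord_div (pair_ord i j) = i.
Proof.
by apply: val_inj; rewrite /= divnMDl ?divn_small ?addn0 //; case: d j => [[]|].
Qed.

Lemma ord_mod_pair p d (i : 'I_p) (j : 'I_d) : ord_mod (pair_ord i j) = j.
Proof. by apply: val_inj; rewrite /= modnMDl modn_small. Qed.

(** [i] selects the block and [j] the place inside it: [j] is appended as the last base-[d]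
    digit. *)
Definition pow_pair d k (i : 'I_(d ^ k)) (j : 'I_d) : 'I_(d ^ k.+1) :=
  cast_ord (esym (expnSr d k)) (pair_ord i j).

Lemma phi_iterS k i j (r : 'I_m) (c : 'I_n) :
  M k.+1 (pow_pair i r) (pow_pair j c) = block (M k i j) r c.
Proof.
by rewrite /= castmxE mxE !cast_ordK !ord_div_pair !ord_mod_pair.
Qed.

Lemma pow_pairP d k (i : 'I_(d ^ k.+1)) : exists j c, i = pow_pair j c.
Proof.
pose i' := cast_ord (expnSr d k) i.
exists (ord_div i'), (ord_mod i'); apply: val_inj => /=.
exact: divn_eq.
Qed.

Lemma ltn_pow_pair d k (i j : 'I_(d ^ k)) (c c' : 'I_d) :
  (i < j)%N -> (pow_pair i c < pow_pair j c')%N.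
Proof. by move=> ij /=; have := ltn_ord c; nia. Qed.

Lemma ltn_pow_pair2 d k (i : 'I_(d ^ k)) (c c' : 'I_d) :
  (c < c')%N -> (pow_pair i c < pow_pair i c')%N.
Proof. by move=> cc' /=; rewrite ltn_add2l. Qed.

Hypotheses (hA : ternary A) (hB : ternary B) (hC : ternary C).

Lemma block_ternary x : ternary (block x).
Proof. by rewrite /Defs.block; case: ifP => // _; case: ifP. Qed.

Lemma phi_iter_ternary k : ternary (M k).
Proof.
case: k => [|k] i j; first by rewrite mxE.
have [P [r ->]] := pow_pairP i; have [Q [c ->]] := pow_pairP j.
by rewrite phi_iterS; apply: block_ternary.
Qed.

Hypothesis st : forall k, semi_transitive (Go (M k)).

(** Two occurrences of [x] become two copies of its block; a row of the block with distinct entries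
    u, v then yields uvuv. *)
Lemma nonlayered_symbol_unique k x P (i j : 'I_(n ^ k)) :
  ~ layered (block x) -> (i < j)%N -> M k P i = x -> M k P j = x -> False.
Proof.
move=> nl ij hi hj; apply: nl.
suff H r (c c' : 'I_n) : (c < c')%N -> block x r c = block x r c'.
  by move=> r c c'; case: (ltngtP c c') => [/H|/H|/val_inj->].
move=> cc'; apply: contrapT => ne.
apply: (row_no_uvuv (st k.+1) (p := pow_pair P r)
  (i1 := pow_pair i c) (j1 := pow_pair i c')
  (i2 := pow_pair j c) (j2 := pow_pair j c') (@phi_iter_ternary _)).
- exact: ltn_pow_pair2.
- exact: ltn_pow_pair.
- exact: ltn_pow_pair2.
- by rewrite !phi_iterS hi.
- by rewrite !phi_iterS hi hj.
- by rewrite !phi_iterS hi hj.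
Qed.

End Powers.

Lemma row_stringP m n (X : 'M[int]_(m, n.+1)) (i : 'I_m) x :
  row_string X i = nseq n 1 ++ [:: x] <->
  (forall j : 'I_n.+1, (j < n)%N -> X i j = 1) /\ X i ord_max = x.
Proof.
have nthE (j : 'I_n.+1) : nth 0 (row_string X i) j = X i j.
  by rewrite (nth_map ord0) ?size_enum_ord // nth_ord_enum.
have nthR j : nth 0 (nseq n 1 ++ [:: x]) j =
    if (j < n)%N then 1 else nth 0 [:: x] (j - n).
  by rewrite nth_cat size_nseq nth_nseq; case: (j < n)%N.
split=> [e|[h1 hx]].
  split=> [j jn|]; first by rewrite -nthE e nthR jn.
  by rewrite -nthE e nthR /= ltnn subnn.
apply: (@eq_from_nth _ 0).
  by rewrite size_map size_enum_ord size_cat size_nseq addn1.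
move=> j; rewrite size_map size_enum_ord => jn.
rewrite (nthE (Ordinal jn)) nthR; case: ltnP => [jn1|nj]; first by rewrite h1.
have -> : Ordinal jn = ord_max by apply: val_inj => /=; lia.
by rewrite hx (_ : j - n = 0)%N; [|lia].
Qed.

(** * Sufficiency: the powers keep the shape of the rows *)

Section Sufficiency.
Context {m n : nat} (A B C : 'M[int]_(m, n.+1)).
Hypotheses (hA : forall i (j : 'I_n.+1), (A i j == 1) = (j < n)%N)
           (hC : forall i (j : 'I_n.+1), (C i j == 1) = (j < n)%N)
           (hB : forall i j, B i j = 1).

(** Every block before the last in a row is [B], all ones; the last is [A] or [C], whose rows differ
    from 1 only at the end. *)
Lemma phi_iter_eq1 k i (j : 'I_(n.+1 ^ k)) :
  (phi_iter A B C k i j == 1) = (j.+1 < n.+1 ^ k)%N.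
Proof.
elim: k => [|k IH] in i j *; first by rewrite mxE; case: j => [[]].
have [P [r ->]] := pow_pairP i; have [Q [c ->]] := pow_pairP j.
rewrite phi_iterS /= [in RHS]expnSr; have := IH P Q.
have := (ltn_ord Q, ltn_ord c); case=> Qlt clt.
have [Q1 /eqP->|Q1 nQ1] := ltnP; first by rewrite /block hB eqxx; nia.
(* Here [Q] is the last block column, so only the position [c] inside the block decides. *)
have eN : (n.+1 ^ k)%N = Q.+1 by lia.
by rewrite /block nQ1; case: ifP => _; rewrite ?hA ?hC [X in (_ < X * _)%N]eN;
   nia.
Qed.

Lemma phi_iter_semi_transitive k : semi_transitive (Go_iter A B C k).
Proof.
apply: transitive_semi_transitive; first exact: Go_irreflexive.
apply: Go_transitive => [p j|p j hj]; first exact: phi_iter_eq1.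
have := phi_iter_eq1 p j; rewrite hj => /esym/negbT; rewrite -leqNgt.
by have := ltn_ord j; lia.
Qed.

End Sufficiency.

(** * Necessity: the shape of B, then A, then C *)

Section Necessity.
Context {m n : nat} (A B C : 'M[int]_(m, n.+2)).
Hypotheses (hA : ternary A) (hB : ternary B) (hC : ternary C)
  (hA0 : exists i j, A i j = 0)
  (hindB : ~ independent_from_B A B C) (hindC : ~ independent_from_C A B C)
  (hlA : ~ layered A) (hlC : ~ layered C) (hlB : layered B)
  (st : forall k, semi_transitive (Go_iter A B C k)).
Local Notation M k := (phi_iter A B C k).

Let row1 (r : 'I_m) : 'I_(m ^ 1) := pow_pair (k := 0) ord0 r.
Let col1 (c : 'I_n.+2) : 'I_(n.+2 ^ 1) := pow_pair (k := 0) ord0 c.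

Let M1E r c : M 1 (row1 r) (col1 c) = A r c.
Proof. by rewrite phi_iterS mxE. Qed.

Let M2E r c s d :
  M 2 (pow_pair (row1 r) s) (pow_pair (col1 c) d) = block A B C (A r c) s d.
Proof. by rewrite phi_iterS M1E. Qed.

Let ltn_col1 (c c' : 'I_n.+2) : (c < c')%N -> (col1 c < col1 c')%N.
Proof. exact: ltn_pow_pair2. Qed.

Let uniq0 k P (i j : 'I_(n.+2 ^ k)) :
  (i < j)%N -> M k P i = 0 -> M k P j = 0 -> False.
Proof. exact: nonlayered_symbol_unique. Qed.

Let uniqN1 k P (i j : 'I_(n.+2 ^ k)) :
  (i < j)%N -> M k P i = -1 -> M k P j = -1 -> False.
Proof. exact: nonlayered_symbol_unique. Qed.

(** Once a 1 occurs in some power, [B] occurs in the next; a constant row of 0 or -1 there would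
    repeat that symbol. *)
Lemma B_eq1 r c : B r c = 1.
Proof.
have [k [P [j hj]]] : exists k P j, M k P j = 1.
  apply: contrapT => no1; apply: hindB => i j.
  have A1 r' c' : A r' c' <> 1.
    by move=> h; apply: no1; exists 1, (row1 r'), (col1 c'); rewrite M1E.
  (* A -1 in [A] would bring [C], and its 1, into the second power; so [A] would be all 0, hence
     layered. *)
  split=> // Cij; apply: hlA => r' c' c''.
  suff A0 d : A r' d = 0 by rewrite !A0.
  have := hA r' d; rewrite !inE => /or3P[]/eqP // Ad; last by case: (A1 _ _ Ad).
  case: no1; exists 2, (pow_pair (row1 r') i), (pow_pair (col1 d) j).
  by rewrite M2E Ad.
have BE d : M k.+1 (pow_pair P r) (pow_pair j d) = B r c.
  by rewrite phi_iterS hj; apply: hlB.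
have lt0m : (pow_pair j ord0 < pow_pair j (@ord_max n.+1))%N.
  exact: ltn_pow_pair2.
have := hB r c; rewrite !inE => /or3P[]/eqP // Brc; exfalso.
- by apply: (uniqN1 (P := pow_pair P r) lt0m); rewrite BE.
- by apply: (uniq0 (P := pow_pair P r) lt0m); rewrite BE.
Qed.

Lemma A_has_neg1 : exists i j, A i j = -1.
Proof.
apply: contrapT => noN1; apply: hindC => i j; split; last by rewrite B_eq1.
by move=> Aij; apply: noN1; exists i, j.
Qed.

(** In row [(P, r1)] of the next power, a -1 from [A] precedes row [r1] of [C], which can then
    contain neither -1 nor 1; its zeros would repeat. *)
Lemma no_0_neg1 k P (i j : 'I_(n.+2 ^ k)) :
  (i < j)%N -> M k P i = 0 -> M k P j = -1 -> False.
Proof.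
have [r1 [c1 A1]] := A_has_neg1 => ij hi hj.
have AN1 : M k.+1 (pow_pair P r1) (pow_pair i c1) = -1 by rewrite phi_iterS hi.
have CE d : M k.+1 (pow_pair P r1) (pow_pair j d) = C r1 d.
  by rewrite phi_iterS hj.
have lt_ij d : (pow_pair i c1 < pow_pair j d)%N by apply: ltn_pow_pair.
have C0 d : C r1 d = 0.
  have := hC r1 d; rewrite !inE => /or3P[]/eqP // Cd; exfalso.
    by apply: (uniqN1 (lt_ij d) AN1); rewrite CE.
  by apply: (row_no_neg1_1 (st _) (lt_ij d) AN1); rewrite CE.
apply: (@uniq0 _ (pow_pair P r1) (pow_pair j ord0) (pow_pair j ord_max)).
- exact: ltn_pow_pair2.
- by rewrite CE.
- by rewrite CE.
Qed.

(** Row [(r, r)] of the second power has row [r] of [C] before row [r] of [A]. Whatever the first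
    entry of the former, it clashes with the -1 and 0 of the latter. *)
Lemma A_no_neg1_0 r (i j : 'I_n.+2) :
  (i < j)%N -> A r i = -1 -> A r j = 0 -> False.
Proof.
move=> ij hi hj; pose P := pow_pair (row1 r) r.
have CE : M 2 P (pow_pair (col1 i) ord0) = C r ord0 by rewrite M2E hi.
have AE d : M 2 P (pow_pair (col1 j) d) = A r d by rewrite M2E hj.
have lt_ij d : (pow_pair (col1 i) ord0 < pow_pair (col1 j) d)%N.
  exact/ltn_pow_pair/ltn_col1.
have := hC r ord0; rewrite !inE => /or3P[]/eqP C0.
- by apply: (@uniqN1 _ P _ _ (lt_ij i)); rewrite ?CE ?AE.
- by apply: (@uniq0 _ P _ _ (lt_ij j)); rewrite ?CE ?AE.
- apply: (@row_no_1_neg1_0 _ _ _ (st 2) P (pow_pair (col1 i) ord0)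
    (pow_pair (col1 j) i) (pow_pair (col1 j) j)); rewrite ?CE ?AE //.
  by rewrite lt_ij ltn_pow_pair2.
Qed.

Lemma A_eq1 r (c : 'I_n.+2) : (c < n.+1)%N -> A r c = 1.
Proof.
have [r1 [c1 A1]] := A_has_neg1; move=> c_lt.
have lt_cm : (c < @ord_max n.+1)%N by [].
have lt_cm1 := ltn_col1 lt_cm.
have := (hA r c, hA r ord_max); rewrite !inE; case.
case/or3P=> /eqP // Ac /or3P[]/eqP Am; exfalso.
- by apply: (@uniqN1 1 (row1 r) _ _ lt_cm1); rewrite M1E.
- exact: A_no_neg1_0 lt_cm Ac Am.
- by apply: (row_no_neg1_1 (st 1) (p := row1 r) lt_cm1); rewrite M1E.
- by apply: (@no_0_neg1 1 (row1 r) _ _ lt_cm1); rewrite M1E.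
- by apply: (@uniq0 1 (row1 r) _ _ lt_cm1); rewrite M1E.
(* For 0 before 1, row [(r, r1)] of the second power has the -1 of row [r1] of [A] before a row of
   [B]. *)
- apply: (row_no_neg1_1 (st 2) (p := pow_pair (row1 r) r1)
    (ltn_pow_pair c1 ord0 lt_cm1)); first by rewrite M2E Ac.
  by rewrite M2E Am B_eq1.
Qed.

Lemma A_last_of r c x : A r c = x -> x != 1 -> A r ord_max = x.
Proof.
move=> Ac x1; have [c_lt|c_ge] := ltnP c n.+1.
  by rewrite -Ac A_eq1 in x1.
by have -> : ord_max = c by apply: val_inj; have := ltn_ord c => /=; lia.
Qed.

Lemma A_last r : A r ord_max <> 1.
Proof.
have [r1 [c1 /A_last_of/(_ isT) A1]] := A_has_neg1 => Ar.
apply: (no_11_over_1neg1 (st 1) (p := row1 r1) (q := row1 r)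
  (i := col1 ord0) (j := col1 ord_max)); rewrite M1E //; exact: A_eq1.
Qed.

(** Row [r1] of [A] is 1..1(-1), so row [(r1, r)] of the second power is a run of ones followed by
    row [r] of [C]; the leading 1 excludes the endings (-1)..0 and 0..1. *)
Lemma C_eq1 r (c : 'I_n.+2) : (c < n.+1)%N -> C r c = 1.
Proof.
have [r1 [c1 /A_last_of/(_ isT) A1]] := A_has_neg1; move=> c_lt.
pose P := pow_pair (row1 r1) r.
have CE d : M 2 P (pow_pair (col1 ord_max) d) = C r d by rewrite M2E A1.
have B1 : M 2 P (pow_pair (col1 ord0) ord0) = 1.
  by rewrite M2E A_eq1 // B_eq1.
have lt_cm : (pow_pair (col1 ord_max) c < pow_pair (col1 ord_max) ord_max)%N.
  exact: ltn_pow_pair2.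
have lt_0cm : (pow_pair (col1 ord0) ord0 < pow_pair (col1 ord_max) c
    < pow_pair (col1 ord_max) ord_max)%N.
  by rewrite lt_cm andbT; apply/ltn_pow_pair/ltn_col1.
have := (hC r c, hC r ord_max); rewrite !inE; case.
case/or3P=> /eqP // Cc /or3P[]/eqP Cm; exfalso.
- by apply: (@uniqN1 2 P _ _ lt_cm); rewrite CE.
- by apply: (row_no_1_neg1_0 (st 2) lt_0cm B1); rewrite CE.
- by apply: (row_no_neg1_1 (st 2) (p := P) lt_cm); rewrite CE.
- by apply: (@no_0_neg1 2 P _ _ lt_cm); rewrite CE.
- by apply: (@uniq0 2 P _ _ lt_cm); rewrite CE.
- have := row_1_convex (st 2) lt_0cm B1.
  by rewrite !CE Cc => /(_ Cm).
Qed.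

(** In the second power, row [(r0, r1)] ends with a row of [A] ending in -1, and row [(r1, r)] with
    row [r] of [C]; both start with 1. *)
Lemma C_last r : C r ord_max <> 1.
Proof.
have [r1 [c1 /A_last_of/(_ isT) A1]] := A_has_neg1.
have [r0 [c0 /A_last_of/(_ isT) A0]] := hA0 => Cr.
apply: (no_11_over_1neg1 (st 2)
  (p := pow_pair (row1 r0) r1) (q := pow_pair (row1 r1) r)
  (i := pow_pair (col1 ord0) ord0) (j := pow_pair (col1 ord_max) ord_max)).
- by rewrite M2E A_eq1 // B_eq1.
- by rewrite M2E A0.
- by rewrite M2E A_eq1 // B_eq1.
- by rewrite M2E A1.
Qed.

End Necessity.

(** * Translation to row strings and conclusion *)

Lemma ternary_row_string m n (X : 'M[int]_(m, n.+1)) (i : 'I_m) :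
  ternary X ->
  (row_string X i = nseq n 1 ++ [:: 0] \/ row_string X i = nseq n 1 ++ [:: -1])
  <-> (forall j : 'I_n.+1, (X i j == 1) = (j < n)%N).
Proof.
move=> hX; rewrite !row_stringP; split=> [h j|h].
  have [jn|nj] := ltnP j n; first by case: h => -[h _]; rewrite h.
  have -> : j = ord_max by apply: val_inj; have := ltn_ord j => /=; lia.
  by case: h => -[_ ->].
have h1 (j : 'I_n.+1) : (j < n)%N -> X i j = 1 by rewrite -h => /eqP.
have := hX i ord_max; rewrite !inE h ltnn orbF.
by case/orP=> /eqP; [right | left].
Qed.

Theorem theorem3p17 (m n : nat) (A B C : 'M[int]_(m, n))
  (hA : ternary A) (hB : ternary B) (hC : ternary C)
  (hA0 : exists i j, A i j = 0)
  (hindB : ~ independent_from_B A B C)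
  (hindC : ~ independent_from_C A B C)
  (hlA : ~ layered A) (hlC : ~ layered C) (hlB : layered B) :
  IST A B C = None <->
  (forall i : 'I_m,
     (row_string A i = nseq n.-1 1 ++ [:: 0] \/
      row_string A i = nseq n.-1 1 ++ [:: -1]) /\
     (row_string C i = nseq n.-1 1 ++ [:: 0] \/
      row_string C i = nseq n.-1 1 ++ [:: -1])) /\
  B = const_mx 1.
Proof.
case: n => [|[|n]] in A B C hA hB hC hA0 hindB hindC hlA hlC hlB *.
(* With fewer than two columns [A] would be layered. *)
- by case: hlA => i [].
- by case: hlA => i j j'; rewrite !ord1.
rewrite IST_NoneP /=; split=> [st|[h hB1]].
  have eq1P (X : 'M[int]_(m, n.+2)) :
      (forall i (j : 'I_n.+2), (j < n.+1)%N -> X i j = 1) ->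
      (forall i, X i ord_max <> 1) ->
    forall i (j : 'I_n.+2), (X i j == 1) = (j < n.+1)%N.
    move=> X1 Xm i j; have [jn|nj] := ltnP; first by rewrite X1.
    have -> : j = ord_max by apply: val_inj; have := ltn_ord j => /=; lia.
    exact/eqP.
  split=> [i|].
    rewrite !ternary_row_string //; split; apply: eq1P => // *.
    + exact: (A_eq1 (B := B) (C := C)).
    + exact: (A_last (B := B) (C := C)).
    + exact: (C_eq1 (A := A) (B := B)).
    + exact: (C_last (A := A) (B := B)).
  by apply/matrixP => i j; rewrite mxE (B_eq1 (A := A) (C := C)).
move=> k; apply: phi_iter_semi_transitive.
- by move=> i; apply/ternary_row_string => //; case: (h i).
- by move=> i; apply/ternary_row_string => //; case: (h i).
- by move=> i j; rewrite hB1 mxE.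
Qed.
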